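(* Let $\mathcal{H}$ be a real Hilbert space, let $F:\mathcal{H}\to\mathcal{H}$ be $L$-Lipschitz continuous ($L>0$) and $\rho$-strongly monotone ($\rho>0$), and set $\gamma:=\frac{L}{\rho}\ge 1$. Let $K:\mathcal{H}\rightrightarrows\mathcal{H}$ be a set-valued mapping with nonempty, closed and convex values, and assume that there is a constant $l$ with $0\le l\le \frac{1}{\gamma(\gamma+\sqrt{\gamma^2-1})}$ such that $$\|P_{K(x)}(z)-P_{K(y)}(z)\|\le l\|x-y\|\qquad \forall x,y,z\in\mathcal{H}.$$ Let $\lambda>0$ and define $f:\mathcal{H}\to\mathcal{H}$ by $$f(x)=P_{K(x)}(x-\lambda F(x))+\lambda\Big(F(x)-F\big(P_{K(x)}(x-\lambda F(x))\big)\Big)-x .$$ Then for every $x_0\in\mathcal{H}$ the dynamical system $$\dot{x}(t)=f(x(t))\quad (t\ge 0),\qquad x(0)=x_0,$$ has a unique solution $x:[0,+\infty)\to\mathcal{H}$.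
   Context: For a nonempty closed convex set $C\subseteq\mathcal{H}$, $P_C:\mathcal{H}\to C$ denotes the metric projection, $P_C(x)=\mathrm{argmin}\{\|x-y\|: y\in C\}$. $F$ is $L$-Lipschitz continuous if $\|F(x)-F(y)\|\le L\|x-y\|$ for all $x,y\in\mathcal{H}$. $F$ is $\rho$-strongly monotone if $\langle x-y,F(x)-F(y)\rangle\ge\rho\|x-y\|^2$ for all $x,y\in\mathcal{H}$. A solution of the dynamical system is a continuously differentiable function on $[0,+\infty)$ satisfying the equation and the initial condition. The system is equivalently written as $y(t)=P_{K(x(t))}(x(t)-\lambda F(x(t)))$, $\dot{x}(t)+x(t)=y(t)+\lambda(F(x(t))-F(y(t)))$, $x(0)=x_0$. *)

(* Defs.v *)
From HB Require Import structures.
From mathcomp Require Import all_boot all_order all_algebra.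
From mathcomp Require Import sesquilinear.
From mathcomp Require Import all_classical all_reals all_analysis.
Import Order.TTheory GRing.Theory Num.Theory.
Import numFieldNormedType.Exports.

Set Implicit Arguments.
Unset Strict Implicit.
Unset Printing Implicit Defensive.

Local Open Scope classical_set_scope.
Local Open Scope ring_scope.

Definition argmin_dist (R : realType) (H : normedModType R) (C : set H)
    (x : H) : set H :=
  [set y | C y /\ forall z, C z -> `|x - y| <= `|x - z|].

(* When C is nonempty, closed and convex in a Hilbert space, the set of
   minimizers is a singleton, so the choice made by xget is the only one. The
   default x is used only if there is no minimizer. *)
Definition metric_proj (R : realType) (H : normedModType R) (C : set H)
    (x : H) : H :=
  xget x (argmin_dist C x).

Definition strongly_monotone (R : realType) (H : normedModType R)
    (dot : H -> H -> R) (rho : R) (F : H -> H) : Prop :=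
  forall x y, rho * `|x - y| ^+ 2 <= dot (x - y) (F x - F y).

Definition vector_field (R : realType) (H : normedModType R) (K : H -> set H)
    (lambda : R) (F : H -> H) (x : H) : H :=
  let y := metric_proj (K x) (x - lambda *: F x) in
  y + lambda *: (F x - F y) - x.

(* The difference quotient is restricted to times in [0, +oo[, so this is the
   two-sided derivative for t > 0 and the right derivative at t = 0. Values of
   x at negative times are irrelevant. *)
Definition has_derivative_at (R : realType) (H : normedModType R)
    (x : R -> H) (t : R) (v : H) : Prop :=
  (s - t)^-1 *: (x s - x t) @[s --> within `[0, +oo[ t^'] --> v.

Definition is_C1 (R : realType) (H : normedModType R) (x dx : R -> H) : Prop :=
  (forall t, 0 <= t -> has_derivative_at x t (dx t)) /\
  {within `[0, +oo[, continuous dx}.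

Definition is_solution (R : realType) (H : normedModType R) (f : H -> H)
    (x0 : H) (x : R -> H) : Prop :=
  exists dx : R -> H,
    [/\ is_C1 x dx, forall t, 0 <= t -> dx t = f (x t) & x 0 = x0].

(* Main.v *)
Require Import Defs.
From HB Require Import structures.
From mathcomp Require Import all_boot all_order all_algebra.
From mathcomp Require Import sesquilinear ring lra.
From mathcomp Require Import all_classical all_reals all_analysis.
Import Order.TTheory GRing.Theory Num.Theory.
Import numFieldNormedType.Exports.

(** The dynamical system is an autonomous ordinary differential equation whose
    right-hand side is globally Lipschitz, so the theorem is an instance of the
    Cauchy-Lipschitz theorem on the half-line.

    The vector field is Lipschitz ([vector_field_lipschitz]) because it is built
    from [F], which is Lipschitz, and from the moving projection
    [x |-> P_{K(x)}(x - lambda F(x))].  Between two points the latter changes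
    for two reasons: the set moves, which [proj_lip] controls, and the projected
    point moves, which is controlled by the nonexpansiveness of the projection
    onto one closed convex set ([metric_proj_nonexpansive]).

    Existence is proved without integrating vector-valued functions.  The
    explicit Euler iterates of mesh [2^-n] started at [x0] form, at each time,
    a sequence whose increments are bounded by a geometric sequence: splitting
    one Euler step of length [h] into two changes its endpoint by an amount of
    order [h ^ 2], and errors are amplified by at most [expR (M * t)] up to
    time [t] ([euler_halving]).  Hence they converge, and the limit is called
    the Euler flow.  The first order Taylor estimate of the iterates, with a
    quadratic remainder that does not depend on the mesh ([euler_taylor]),
    passes to the limit and says that the Euler flow is differentiable and
    solves the equation ([euler_flow_derivative]).

    Uniqueness is a Gronwall argument for the squared norm of the difference
    of two solutions ([gronwall_norm_sqr]); in a Hilbert space this is a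
    differentiable real function, so that only real calculus is involved. *)

Set Implicit Arguments.
Unset Strict Implicit.
Unset Printing Implicit Defensive.

Local Open Scope classical_set_scope.
Local Open Scope ring_scope.

(** * Inner product identities *)

Section InnerProduct.
Context (R : realType) (H : normedModType R) (dot : {dot H for idfun}).
Context (dotE : forall u : H, dot u u = `|u| ^+ 2).
Implicit Types (u v : H) (a : R).

Lemma dotC u v : dot u v = dot v u.
Proof. by rewrite hermC /= expr0 mul1r. Qed.

Lemma dotZr a u v : dot u (a *: v) = a * dot u v.
Proof. by rewrite linearZ. Qed.

Lemma dotBl u v w : dot (u - v) w = dot u w - dot v w.
Proof. exact: linearBl. Qed.

Lemma dotBr u v w : dot u (v - w) = dot u v - dot u w.
Proof. exact: linearBr. Qed.

Lemma dotDl u v w : dot (u + v) w = dot u w + dot v w.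
Proof. exact: linearDl. Qed.

Lemma normB_sqr u v : `|u - v| ^+ 2 = `|u| ^+ 2 - 2 * dot u v + `|v| ^+ 2.
Proof. by rewrite -!dotE dotBl !dotBr (dotC v u); ring. Qed.

Lemma normD_sqr u v : `|u + v| ^+ 2 = `|u| ^+ 2 + 2 * dot u v + `|v| ^+ 2.
Proof.
have -> : u + v = u - (-1 *: v) by rewrite scaleN1r opprK.
by rewrite normB_sqr dotZr scaleN1r normrN; ring.
Qed.

Lemma parallelogram u v :
  `|u + v| ^+ 2 + `|u - v| ^+ 2 = 2 * (`|u| ^+ 2 + `|v| ^+ 2).
Proof. by rewrite normD_sqr normB_sqr; ring. Qed.

Lemma polarization u v : dot u v = 4^-1 * (`|u + v| ^+ 2 - `|u - v| ^+ 2).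
Proof. by rewrite normD_sqr normB_sqr; field. Qed.

Lemma dot_sum_diff u v : dot (u + v) (u - v) = `|u| ^+ 2 - `|v| ^+ 2.
Proof. by rewrite dotBr !dotDl !dotE (dotC v u); ring. Qed.

(** This weak form of the Cauchy-Schwarz inequality suffices both for the
    nonexpansiveness of projections and for the Gronwall argument. *)
Lemma dot_le u v : 2 * dot u v <= `|u| ^+ 2 + `|v| ^+ 2.
Proof. by have := sqr_ge0 `|u - v|; rewrite normB_sqr; lra. Qed.

(** By polarization the inner product is a combination of squared norms, so its
    continuity follows from that of the norm. *)
Lemma cvg_dot {T} (F : set_system T) {FF : Filter F} (g h : T -> H) u v :
  g @ F --> u -> h @ F --> v -> dot (g t) (h t) @[t --> F] --> dot u v.
Proof.
move=> gu hv; rewrite polarization; under eq_fun do rewrite polarization.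
apply: cvgMl_tmp; apply: cvgB; rewrite expr2; under eq_fun do rewrite expr2.
  by apply: cvgM; apply: cvg_norm; exact: cvgD.
by apply: cvgM; apply: cvg_norm; exact: cvgB.
Qed.

End InnerProduct.

(** * Projection onto a closed convex set *)

Lemma convex_set_comb {R : realType} {H : normedModType R} {C : set H} :
  convex_set (C : set (convex_lmodType H)) ->
  forall (a b : H) (k : R), 0 <= k <= 1 -> C a -> C b ->
  C (k *: a + (1 - k) *: b).
Proof.
move=> cC a b k /andP[k0 k1] Ca Cb.
by have /set_mem := cC a b (Itv01 k0 k1) (mem_set Ca) (mem_set Cb).
Qed.

Section Projection.
Context (R : realType) (H : completeNormedModType R) (dot : {dot H for idfun}).
Context (dotE : forall u : H, dot u u = `|u| ^+ 2).
Context {C : set H} (C0 : C !=set0) (Ccl : closed C)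
  (Ccv : convex_set (C : set (convex_lmodType H))).

(** A minimizing sequence is Cauchy: by the parallelogram law, two points whose
    squared distances to [x] are within [e] of the infimum [d] are at squared
    distance less than [4 * e], since their midpoint is in [C] and therefore
    not closer to [x] than the infimum. *)
Lemma argmin_dist_nonempty (x : H) : argmin_dist C x !=set0.
Proof.
pose D := [set `|x - z| ^+ 2 | z in C].
have D0 : has_inf D.
  split; first by case: C0 => z Cz; exists (`|x - z| ^+ 2), z.
  by exists 0 => _ [z _ <-]; exact: sqr_ge0.
pose d := inf D.
have d_le z : C z -> d <= `|x - z| ^+ 2.
  by move=> Cz; apply: ge_inf; [exact: D0.2|exists z].
have near_min (e : R) : 0 < e -> exists z, C z /\ `|x - z| ^+ 2 < d + e.
  by move=> e0; have [_ [z Cz <-] zd] := inf_adherent e0 D0; exists z.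
have min_close (e : R) a b : C a -> C b ->
    `|x - a| ^+ 2 < d + e -> `|x - b| ^+ 2 < d + e -> `|a - b| ^+ 2 < 4 * e.
  move=> Ca Cb xa xb.
  have := parallelogram dotE (x - a) (x - b).
  pose m := 2^-1 *: a + (1 - 2^-1) *: b.
  have -> : x - a + (x - b) = 2 *: (x - m).
    rewrite scalerBr scalerDr !scalerA mulrBr mulr1 divff ?pnatr_eq0//.
    rewrite -(natrB _ (isT : 1 <= 2)%N) subSS subn0 !scale1r scaler_nat.
    by rewrite addrACA -opprD mulr2n.
  have -> : x - a - (x - b) = - (a - b).
    by rewrite [- (a - b)]opprB opprB addrC addrA subrK.
  have : d <= `|x - m| ^+ 2 by apply/d_le/convex_set_comb => //; lra.
  rewrite normrN normrZ exprMn gtr0_norm//.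
  lra.
pose u n := sval (cid (near_min n.+1%:R^-1 ltac:(by rewrite invr_gt0))).
have uC n : C (u n) by rewrite /u; case: cid => /= z [].
have ud n : `|x - u n| ^+ 2 < d + n.+1%:R^-1.
  by rewrite /u; case: cid => /= z [].
have u_cauchy : cauchy (u @ \oo).
  apply: cauchy_exP => e e0.
  have e2 : 0 < e ^+ 2 / 4 by rewrite divr_gt0// exprn_gt0.
  have [N _ NP] := near_infty_natSinv_lt (PosNum e2).
  exists (u N); exists N => // n /= Nn.
  rewrite -ball_normE /=.
  have := NP N (leqnn N); rewrite /= => Ne.
  have := min_close _ _ _ (uC N) (uC n) (lt_trans (ud N) _) (lt_trans (ud n) _).
  move=> /(_ (e ^+ 2 / 4)); rewrite !ltrD2l.
  move=> /(_ Ne (NP n Nn)).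
  by rewrite mulrCA divff ?pnatr_eq0// mulr1 ltr_pXn2r// nnegrE// ltW.
have /cvg_ex[p up] : cvg (u @ \oo) by exact/cauchy_cvgP.
have Cp : C p by apply: (closed_cvg _ Ccl _ _ up); exact: nearW.
have xp : `|x - p| ^+ 2 <= d.
  apply: (@ler_cvg_to _ \oo%classic _ _ (fun n => `|x - u n| ^+ 2)
    (fun n => d + n.+1%:R^-1)).
  - rewrite expr2; under eq_fun do rewrite expr2.
    by apply: cvgM; apply: cvg_norm; apply: cvgB => //; exact: cvg_cst.
  - rewrite -[X in _ --> X]addr0; apply: cvgD; first exact: cvg_cst.
    exact: cvg_harmonic.
  - by near=> n; exact/ltW.
exists p; split=> // z Cz.
rewrite -(@ler_pXn2r _ 2)// ?nnegrE//.
exact: le_trans xp (d_le _ Cz).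
Unshelve. all: by end_near. Qed.

Lemma metric_projP (x : H) : argmin_dist C x (metric_proj C x).
Proof. by apply: xgetPex; exact: argmin_dist_nonempty. Qed.

(** Moving from the projection [p] towards [c] by a fraction [k] cannot decrease
    the distance to [x], which bounds twice the inner product by
    [k * `|c - p| ^+ 2]; then [k] tends to 0. *)
Lemma metric_proj_variational (x c : H) : C c ->
  dot (x - metric_proj C x) (c - metric_proj C x) <= 0.
Proof.
move=> Cc; have [Cp pmin] := metric_projP x.
set p := metric_proj C x in Cp pmin *.
set b := dot _ _; pose n := `|c - p| ^+ 2.
have small (k : R) : 0 < k -> k <= 1 -> 2 * b <= k * n.
  move=> k0 k1.
  have := pmin _ (convex_set_comb Ccv (ltac:(lra) : 0 <= k <= 1) Cc Cp).
  have -> : x - (k *: c + (1 - k) *: p) = x - p - k *: (c - p).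
    by rewrite scalerBl scale1r scalerBr [k *: c + _]addrC opprD opprD opprK
      -!addrA opprB; congr (_ + (_ + _)); rewrite addrC.
  rewrite -[_ <= `|_|](@ler_pXn2r _ 2)// ?nnegrE// (normB_sqr dotE (x - p)).
  rewrite dotZr normrZ exprMn gtr0_norm// -/b -/n => h.
  by rewrite -(ler_pM2l k0); lra.
have n0 : 0 <= n by exact: sqr_ge0.
rewrite leNgt; apply/negP => b0.
(* This fraction is in ]0, 1] and violates the bound when [b > 0]. *)
have := small (b / (b + n)) ltac:(rewrite divr_gt0//; lra)
  ltac:(rewrite ler_pdivrMr; lra).
rewrite mulrAC ler_pdivlMr; last lra.
nra.
Qed.

(** Adding the variational inequalities of the two projections, each tested at
    the other one, bounds the squared distance between the projections by its
    inner product with [x - y]. *)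
Lemma metric_proj_nonexpansive (x y : H) :
  `|metric_proj C x - metric_proj C y| <= `|x - y|.
Proof.
have [Cp _] := metric_projP x; have [Cq _] := metric_projP y.
have := metric_proj_variational x Cq; have := metric_proj_variational y Cp.
set p := metric_proj C x; set q := metric_proj C y => vy vx.
have key : `|p - q| ^+ 2 <= dot (x - y) (p - q).
  rewrite -dotE; move: vx vy; rewrite !(dotBl, dotBr) (dotC dot q p). lra.
have := dot_le dotE (x - y) (p - q).
rewrite -[_ <= `|x - y|](@ler_pXn2r _ 2)// ?nnegrE//; lra.
Qed.

End Projection.

(** * Lipschitz maps *)

Lemma lipschitz_normB {R : realType} {H : normedModType R} {f : H -> H}
    {M : R} :
  M.-lipschitz f -> forall a b, `|f a - f b| <= M * `|a - b|.
Proof. by move=> f_lip a b; exact: (f_lip (a, b)). Qed.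

Lemma lipschitz_continuous {R : realType} {H : normedModType R} {f : H -> H}
    {M : R} :
  (forall a b, `|f a - f b| <= M * `|a - b|) -> continuous f.
Proof.
move=> f_lip a; apply/cvgrPdist_le => e e0.
have M1 : 0 < `|M| + 1 by rewrite ltr_wpDl.
near=> b; apply: (le_trans (f_lip a b)).
apply: (@le_trans _ _ ((`|M| + 1) * `|a - b|)).
  by rewrite ler_wpM2r// (le_trans (ler_norm _))// lerDl.
rewrite mulrC -ler_pdivlMr//; near: b.
apply: (@cvgr_dist_le _ _ _ (nbhs a)) => //; exact: divr_gt0.
Unshelve. all: by end_near. Qed.

(** * Euler iterates of a Lipschitz vector field *)

Section EulerScheme.
Context (R : realType) (H : normedModType R) (f : H -> H) (M : R).
Context (M_ge0 : 0 <= M) (f_lip : forall a b, `|f a - f b| <= M * `|a - b|).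
Implicit Types (h : R) (z : H) (k : nat).

Definition euler h z k := iter k (fun y => y + h *: f y) z.

Lemma eulerS h z k : euler h z k.+1 = euler h z k + h *: f (euler h z k).
Proof. by []. Qed.

Lemma euler_add h z j k : euler h z (j + k) = euler h (euler h z k) j.
Proof. exact: iterD. Qed.

(** [growth h z k] is the bound for the speed along the Euler iterates after [k]
    steps; every error estimate below is a polynomial in the elapsed time
    [k%:R * h] times this bound. *)
Let growth h z k := expR (M * (k%:R * h)) * `|f z|.

Let growth_ge0 h z k : 0 <= growth h z k.
Proof. by rewrite mulr_ge0// expR_ge0. Qed.

Let growthS h z k : growth h z k.+1 = expR (M * h) * growth h z k.
Proof.
by rewrite /growth [RHS]mulrA -expRD -natr1; congr (expR _ * _); ring.
Qed.

Let growth_leS h z k : 0 <= h -> growth h z k <= growth h z k.+1.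
Proof.
by move=> h0; rewrite growthS ler_peMl// -expR0 ler_expR mulr_ge0.
Qed.

(** One step multiplies the speed by at most [1 + M * h <= expR (M * h)]. *)
Lemma euler_field_le h z k : 0 <= h ->
  `|f (euler h z k)| <= expR (M * (k%:R * h)) * `|f z|.
Proof.
move=> h0; rewrite -/(growth h z k); elim: k => [|k IH].
  by rewrite /growth mul0r mulr0 expR0 mul1r.
rewrite eulerS growthS; set y := euler h z k in IH *.
have le_fy : `|f (y + h *: f y)| <= (1 + M * h) * `|f y|.
  have := f_lip (y + h *: f y) y; rewrite addrAC subrr add0r normrZ ger0_norm//.
  have := ler_normD (f (y + h *: f y) - f y) (f y); rewrite subrK. lra.
apply: (le_trans le_fy); apply: ler_pM => //; last exact: expR_ge1Dx.
by rewrite addr_ge0// mulr_ge0.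
Qed.

Lemma euler_displacement_le h z k : 0 <= h ->
  `|euler h z k - z| <= k%:R * h * (expR (M * (k%:R * h)) * `|f z|).
Proof.
move=> h0; rewrite -/(growth h z k); elim: k => [|k IH].
  by rewrite subrr normr0 !mul0r.
have := euler_field_le z k h0; rewrite -/(growth h z k) => fy.
rewrite eulerS; set y := euler h z k in IH fy *.
apply: (le_trans (y := k.+1%:R * h * growth h z k)); last first.
  by rewrite ler_wpM2l ?growth_leS// mulr_ge0.
rewrite addrAC (le_trans (ler_normD _ _))// normrZ ger0_norm//.
have : h * `|f y| <= h * growth h z k by rewrite ler_wpM2l.
rewrite -natr1; lra.
Qed.

(** Each step moves by [h] times a value of [f] that differs from [f z] by at
    most [M] times the displacement.  The bound involves the step only through
    the elapsed time, hence it survives the limit of vanishing step. *)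
Lemma euler_taylor h z k : 0 <= h ->
  `|euler h z k - z - (k%:R * h) *: f z| <=
  M * (k%:R * h) ^+ 2 * (expR (M * (k%:R * h)) * `|f z|).
Proof.
move=> h0; rewrite -/(growth h z k); elim: k => [|k IH].
  by rewrite subrr mul0r scale0r subr0 normr0 expr0n/= mulr0 mul0r.
have := euler_displacement_le z k h0; rewrite -/(growth h z k) => yz.
rewrite eulerS; set y := euler h z k in IH yz *.
apply: (le_trans (y := M * (k.+1%:R * h) ^+ 2 * growth h z k)); last first.
  by rewrite ler_wpM2l ?growth_leS// mulr_ge0// sqr_ge0.
have -> : y + h *: f y - z - (k.+1%:R * h) *: f z =
    (y - z - (k%:R * h) *: f z) + h *: (f y - f z).
  rewrite -natr1 mulrDl mul1r scalerDl scalerBr.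
  by rewrite [y + _ - z]addrAC opprD addrACA.
rewrite (le_trans (ler_normD _ _))// normrZ ger0_norm//.
have : h * `|f y - f z| <= h * (M * (k%:R * h * growth h z k)).
  by rewrite ler_wpM2l// (le_trans (f_lip _ _))// ler_wpM2l.
have : 0 <= M * h ^+ 2 * growth h z k * (k%:R + 1).
  by rewrite !mulr_ge0// ?sqr_ge0// addr_ge0.
rewrite -natr1; lra.
Qed.

(** Two half steps and one full step from the same point [a] differ by
    [M * h ^ 2 / 4 * `|f a|] at most, and two half steps expand distances by at
    most [(1 + M * h / 2) ^ 2 <= expR (M * h)].  The sum of [k] such local
    errors is of order [h] times the elapsed time. *)
Lemma euler_halving h z k : 0 <= h ->
  `|euler (h / 2) z k.*2 - euler h z k| <=
  M * h * (k%:R * h) * (expR (M * (k%:R * h)) * `|f z|).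
Proof.
move=> h0; rewrite -/(growth h z k); elim: k => [|k IH].
  by rewrite subrr normr0 mul0r mulr0 mul0r.
have := euler_field_le z k h0; rewrite -/(growth h z k) => fa.
rewrite doubleS !eulerS; set b := euler (h / 2) z _ in IH *.
set a := euler h z k in IH fa *; set b' := b + (h / 2) *: f b.
have -> : b' + (h / 2) *: f b' - (a + h *: f a) =
    b - a + (h / 2) *: (f b - f a) + (h / 2) *: (f b' - f a).
  rewrite {1}/b' !scalerBr {3}(splitr h) scalerDl.
  by rewrite [b - a + _]addrACA -opprD [RHS]addrACA -opprD addrA.
have h2 : 0 <= h / 2 by lra.
have half_step : `|b' - a| <= (1 + M * (h / 2)) * `|b - a| + h / 2 * `|f a|.
  rewrite /b' addrAC (le_trans (ler_normD _ _))// normrZ ger0_norm//.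
  have : h / 2 * `|f b| <= h / 2 * (M * `|b - a| + `|f a|).
    rewrite ler_wpM2l// -[leLHS]/(`|f b|) -{1}(subrK (f a) (f b)).
    by rewrite (le_trans (ler_normD _ _))// lerD2r.
  lra.
have field_half_step : `|f b' - f a| <=
    M * ((1 + M * (h / 2)) * `|b - a| + h / 2 * `|f a|).
  by rewrite (le_trans (f_lip _ _))// ler_wpM2l.
have q : (1 + M * (h / 2)) ^+ 2 <= expR (M * h).
  have -> : expR (M * h) = expR (M * (h / 2)) ^+ 2.
    by rewrite -expRM_natl; congr expR; field.
  rewrite ler_pXn2r ?nnegrE ?expR_ge0 ?expR_ge1Dx//.
  by rewrite addr_ge0// mulr_ge0.
apply: (@le_trans _ _
  ((1 + M * (h / 2)) ^+ 2 * `|b - a| + M * h ^+ 2 / 4 * `|f a|)).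
  rewrite (le_trans (ler_normD _ _))//.
  rewrite (le_trans (lerD (ler_normD _ _) (lexx _)))//.
  rewrite normrZ (ger0_norm h2) normrZ (ger0_norm h2).
  have : h / 2 * `|f b - f a| <= h / 2 * (M * `|b - a|) by rewrite ler_wpM2l.
  have := ler_wpM2l h2 field_half_step.
  lra.
apply: (@le_trans _ _ (expR (M * h) * (M * h * (k%:R * h) * growth h z k) +
  M * h ^+ 2 * growth h z k.+1)).
  apply: lerD.
    by apply: ler_pM => //; exact: sqr_ge0.
  apply: ler_pM => //; first by rewrite !mulr_ge0// sqr_ge0.
    have : 0 <= M * h ^+ 2 by rewrite mulr_ge0// sqr_ge0.
    lra.
  exact: le_trans fa (growth_leS _ _ h0).
by rewrite growthS -natr1 le_eqVlt; apply/orP; left; apply/eqP; ring.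
Qed.

End EulerScheme.

(** * The limit of Euler iterates *)

Lemma geometric_increments_cvg {R : realType} {H : completeNormedModType R}
    (u : nat -> H) (C : R) :
  (forall n, `|u n.+1 - u n| <= C * 2^-1 ^+ n) -> cvg (u @ \oo).
Proof.
move=> uS.
have C0 : 0 <= C by have := uS 0; rewrite expr0 mulr1; apply: le_trans.
have tail n k : `|u (n + k)%N - u n| <= 2 * C * 2^-1 ^+ n * (1 - 2^-1 ^+ k).
  elim: k => [|k IH]; first by rewrite addn0 subrr normr0 expr0 subrr mulr0.
  rewrite addnS -(subrK (u (n + k)%N) (u _.+1)) -addrA.
  rewrite (le_trans (ler_normD _ _))// (le_trans (lerD (uS _) IH))//.
  by rewrite exprD exprS; lra.
apply/cauchy_cvgP; apply: cauchy_exP => e e0.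
have : \forall n \near \oo, geometric (2 * C) 2^-1 n < e.
  apply: cvgr_lt; last exact: e0.
  by apply: cvg_geometric; rewrite ger0_norm//; lra.
move=> [N _ NP]; exists (u N); exists N => // n /= Nn.
rewrite -ball_normE /= distrC -(subnKC Nn) (le_lt_trans (tail _ _))//.
apply: le_lt_trans (NP N (leqnn N)); rewrite /= ler_piMr//.
by rewrite !mulr_ge0// exprn_ge0.
Qed.

(** When the mesh is halved, the number of steps made before a given time
    doubles, up to one additional step. *)
Lemma truncn_double {R : realType} (v : R) : 0 <= v ->
  Num.truncn (v * 2) = (Num.truncn v).*2 \/
  Num.truncn (v * 2) = (Num.truncn v).*2.+1.
Proof.
move=> v0; have /andP[lo hi] := truncn_itv v0; rewrite -natr1 in hi.
have [vlt|vge] := ltP v ((Num.truncn v)%:R + 2^-1); [left|right];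
  apply: truncn_def; rewrite -?natr1 -mul2n natrM; lra.
Qed.

Section EulerFlow.
Context (R : realType) (H : completeNormedModType R) (f : H -> H) (M : R).
Context (M_ge0 : 0 <= M) (f_lip : forall a b, `|f a - f b| <= M * `|a - b|).
Context (x0 : H).
Implicit Types (s t : R) (n : nat).

Let mesh n : R := 2^-1 ^+ n.

Let mesh_ge0 n : 0 <= mesh n. Proof. exact: exprn_ge0. Qed.

Let mesh_cvg0 : mesh n @[n --> \oo] --> 0.
Proof. by apply: cvg_expr; rewrite ger0_norm//; lra. Qed.

Definition nsteps n t := Num.truncn (t * 2 ^+ n).

(** The approximations are constant between grid times: only the limit has to be
    continuous, and interpolation would complicate the estimates. *)
Definition euler_approx n t := euler f (2^-1 ^+ n) x0 (nsteps n t).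

Definition euler_flow t := lim (euler_approx n t @[n --> \oo]).

Let grid_time n t := (nsteps n t)%:R * mesh n.

Let time_le n t : 0 <= t -> grid_time n t <= t.
Proof.
move=> t0; rewrite /grid_time /mesh exprVn ler_pdivrMr ?exprn_gt0//.
by rewrite truncn_le mulr_ge0// exprn_ge0.
Qed.

Let time_ge n t : 0 <= t -> t - mesh n <= grid_time n t.
Proof.
move=> t0; rewrite lerBlDr -[X in _ + X]mul1r -mulrDl natr1 /mesh exprVn.
by rewrite ler_pdivlMr ?exprn_gt0// ltW// truncnS_gt.
Qed.

Let time_ge0 n t : 0 <= grid_time n t. Proof. by rewrite mulr_ge0. Qed.

Let time_cvg t : 0 <= t -> grid_time n t @[n --> \oo] --> t.
Proof.
move=> t0; apply: (@squeeze_cvgr _ _ _ _ (fun n => t - mesh n) (fun=> t)).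
- by near=> n; rewrite time_ge// time_le.
- by rewrite -[X in _ --> X]subr0; apply: cvgB => //; exact: cvg_cst.
- exact: cvg_cst.
Unshelve. all: by end_near. Qed.

Let expR_time_le n t : 0 <= t -> expR (M * grid_time n t) <= expR (M * t).
Proof. by move=> t0; rewrite ler_expR ler_wpM2l// time_le. Qed.

(** Passing from mesh [2^-n] to [2^-n.+1] changes the approximation by the
    accumulated error of [euler_halving] and possibly by one more half step,
    both of order [2^-n]. *)
Lemma euler_approx_cvg t : 0 <= t ->
  euler_approx n t @[n --> \oo] --> euler_flow t.
Proof.
move=> t0; apply: (@geometric_increments_cvg _ _ _
    ((M * t + 1) * (expR (M * t) * `|f x0|))) => n.
rewrite /euler_approx -/(mesh n) -/(mesh n.+1).
set N := nsteps n t; set g := _ * `|f x0|.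
have g0 : 0 <= g by rewrite mulr_ge0// expR_ge0.
have meshS : mesh n.+1 = mesh n / 2 by rewrite /mesh exprS mulrC.
have gN : expR (M * (N%:R * mesh n)) * `|f x0| <= g.
  by rewrite ler_wpM2r// expR_time_le.
have halved : `|euler f (mesh n / 2) x0 N.*2 - euler f (mesh n) x0 N| <=
    M * mesh n * t * g.
  apply: (le_trans (euler_halving M_ge0 f_lip _ _ _)) => //.
  apply: ler_pM => //; rewrite ?mulr_ge0 ?expR_ge0//.
  by rewrite ler_wpM2l ?mulr_ge0// time_le.
have : nsteps n.+1 t = N.*2 \/ nsteps n.+1 t = N.*2.+1.
  rewrite /nsteps exprSr mulrA; apply: truncn_double.
  by rewrite mulr_ge0// exprn_ge0.
rewrite meshS => -[|] ->.
  rewrite (le_trans halved)//.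
  have : 0 <= g * mesh n by rewrite mulr_ge0.
  lra.
rewrite eulerS addrAC (le_trans (ler_normD _ _))//.
have h2 : 0 <= mesh n / 2 by rewrite divr_ge0.
rewrite normrZ (ger0_norm h2).
have : mesh n / 2 * `|f (euler f (mesh n / 2) x0 N.*2)| <= mesh n / 2 * g.
  rewrite ler_wpM2l// (le_trans (euler_field_le M_ge0 f_lip _ _ h2))//.
  by rewrite (_ : N.*2%:R * (mesh n / 2) = N%:R * mesh n)// -mul2n natrM; field.
have : 0 <= g * mesh n by rewrite mulr_ge0.
lra.
Qed.

Lemma euler_flow0 : euler_flow 0 = x0.
Proof.
rewrite /euler_flow (_ : (fun n => euler_approx n 0) = fun=> x0) ?lim_cst//.
by apply/funext => n; rewrite /euler_approx /nsteps mul0r truncn0.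
Qed.

Let field_cvg t : 0 <= t ->
  f (euler_approx n t) @[n --> \oo] --> f (euler_flow t).
Proof.
move=> t0; apply: continuous_cvg; last exact: euler_approx_cvg.
exact: (lipschitz_continuous f_lip).
Qed.

Lemma euler_flow_field_le t : 0 <= t ->
  `|f (euler_flow t)| <= expR (M * t) * `|f x0|.
Proof.
move=> t0; apply: (@ler_cvg_to _ \oo%classic _ _
  (fun n => `|f (euler_approx n t)|) (fun=> expR (M * t) * `|f x0|)).
- by apply: cvg_norm; exact: field_cvg.
- exact: cvg_cst.
- near=> n; rewrite (le_trans (euler_field_le M_ge0 f_lip _ _ (mesh_ge0 n)))//.
  by rewrite ler_wpM2r// expR_time_le.
Unshelve. all: by end_near. Qed.

(** Up to time [t], the approximation continues from its value at time [s] by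
    Euler steps of total duration close to [t - s], to which [euler_taylor]
    applies. *)
Lemma euler_flow_taylor s t : 0 <= s -> s <= t ->
  `|euler_flow t - euler_flow s - (t - s) *: f (euler_flow s)| <=
  M * (t - s) ^+ 2 * (expR (M * (t - s)) * `|f (euler_flow s)|).
Proof.
move=> s0 st; have t0 := le_trans s0 st.
pose r n := grid_time n t - grid_time n s.
have r_cvg : r n @[n --> \oo] --> t - s by apply: cvgB; exact: time_cvg.
have ns n : (nsteps n s <= nsteps n t)%N.
  by apply: le_truncn; rewrite ler_wpM2r// exprn_ge0.
apply: (@ler_cvg_to _ \oo%classic _ _
  (fun n =>
     `|euler_approx n t - euler_approx n s - r n *: f (euler_approx n s)|)
  (fun n => M * r n ^+ 2 * (expR (M * r n) * `|f (euler_approx n s)|))).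
- apply: cvg_norm; apply: cvgB.
    by apply: cvgB; exact: euler_approx_cvg.
  by apply: cvgZ => //; exact: field_cvg.
- apply: cvgM.
    apply: cvgMl_tmp; rewrite expr2; under eq_fun do rewrite expr2.
    exact: cvgM.
  apply: cvgM; last by apply: cvg_norm; exact: field_cvg.
  apply: continuous_cvg; first exact: continuous_expR.
  exact: cvgMl_tmp.
- near=> n.
  have := euler_taylor M_ge0 f_lip (euler_approx n s)
    (nsteps n t - nsteps n s) (mesh_ge0 n).
  by rewrite /euler_approx -euler_add subnK// natrB// mulrBl.
Unshelve. all: by end_near. Qed.

(** The Taylor estimate looks forward in time only.  For [s < t] it is applied
    at [s], and [f] at time [s] is replaced by [f] at time [t] at a cost of
    order [(t - s) ^ 2], because [f] is Lipschitz and the speed of the flow is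
    at most [A] before time [t + 1]. *)
Lemma euler_flow_quadratic t : 0 <= t ->
  exists2 B, 0 <= B & forall s, 0 <= s -> `|s - t| <= 1 ->
  `|euler_flow s - euler_flow t - (s - t) *: f (euler_flow t)| <=
  B * `|s - t| ^+ 2.
Proof.
move=> t0; set x := euler_flow.
pose A := expR (M * (t + 1)) * `|f x0|; pose e := expR M.
have A0 : 0 <= A by rewrite mulr_ge0// expR_ge0.
have e0 : 0 <= e by exact: expR_ge0.
have fA s : 0 <= s -> s <= t + 1 -> `|f (x s)| <= A.
  move=> s0 st; rewrite (le_trans (euler_flow_field_le s0))//.
  by rewrite ler_wpM2r// ler_expR ler_wpM2l.
have forward a b : 0 <= a -> a <= b -> b - a <= 1 -> a <= t + 1 ->
    `|x b - x a - (b - a) *: f (x a)| <= M * e * A * (b - a) ^+ 2.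
  move=> a0 ab ba at1; apply: (le_trans (euler_flow_taylor a0 ab)).
  rewrite (_ : M * e * A * _ = M * (b - a) ^+ 2 * (e * A)); last by ring.
  rewrite ler_wpM2l ?mulr_ge0 ?subr_ge0//; apply: ler_pM => //.
  - by rewrite ler_expR ler_piMr.
  - exact: fA.
exists (M * e * A + M * A * (1 + M * e)).
  by rewrite addr_ge0// !mulr_ge0// addr_ge0// mulr_ge0.
have M2 : 0 <= M * A * (1 + M * e) by rewrite !mulr_ge0// addr_ge0// mulr_ge0.
move=> s s0; have [ts|st] := leP t s.
  rewrite ger0_norm ?subr_ge0// => st1.
  apply: (le_trans (forward t s t0 ts st1 _)).
    by lra.
  have := mulr_ge0 M2 (sqr_ge0 (s - t)); lra.
rewrite [`|s - t|]distrC gtr0_norm ?subr_gt0// => st1.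
set d := t - s.
have d0 : 0 <= d by rewrite subr_ge0 ltW.
have F := forward s t s0 (ltW st) st1 ltac:(lra).
have -> : x s - x t - (s - t) *: f (x t) =
    - (x t - x s - d *: f (x s)) + d *: (f (x t) - f (x s)).
  rewrite -(opprB t s) scaleNr opprK scalerBr opprB [RHS]addrC addrA subrK.
  by rewrite opprB addrC.
have disp : `|x t - x s| <= d * A + M * e * A * d ^+ 2.
  rewrite -[x t - x s](subrK (d *: f (x s))) (le_trans (ler_normD _ _))//.
  rewrite addrC lerD// normrZ ger0_norm// ler_wpM2l//; apply: fA => //; lra.
rewrite (le_trans (ler_normD _ _))// normrN normrZ (ger0_norm d0).
have := ler_wpM2l d0 (f_lip (x t) (x s)).
have := ler_wpM2l (mulr_ge0 d0 M_ge0) disp.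
have : 0 <= M * A * (M * e) * (d ^+ 2 * (1 - d)).
  by rewrite !mulr_ge0// ?sqr_ge0// subr_ge0.
rewrite -/d in F.
lra.
Qed.

Lemma euler_flow_derivative t : 0 <= t ->
  has_derivative_at euler_flow t (f (euler_flow t)).
Proof.
move=> t0; have [B B0 quad] := euler_flow_quadratic t0.
apply/cvgrPdist_le => e e0.
have d0 : 0 < Num.min 1 (e / (B + 1)).
  by rewrite lt_min ltr01 divr_gt0// ltr_wpDl.
rewrite near_withinE; near=> s => s_ge0.
have st : s - t != 0 by rewrite subr_eq0; near: s; exact: nbhs_dnbhs_neq.
have : `|t - s| < Num.min 1 (e / (B + 1)).
  near: s; apply: nbhs_dnbhs; apply: (@cvgr_dist_lt _ _ _ (nbhs t)) => //.
rewrite lt_min distrC => /andP[/ltW st1 ste].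
have sge0 : 0 <= s by move: s_ge0; rewrite /= in_itv/= andbT.
rewrite distrC.
rewrite -[f _](scalerK st) -scalerBr normrZ normfV ler_pdivrMl ?normr_gt0//.
apply: (le_trans (quad s sge0 st1)).
rewrite expr2 mulrA mulrC ler_wpM2l//.
move: ste; rewrite ltr_pdivlMr ?ltr_wpDl// => ste.
have := normr_ge0 (s - t); lra.
Unshelve. all: by end_near. Qed.

End EulerFlow.

(** * Derivatives on the half-line *)

Section HalfLineDerivative.
Context (R : realType) (H : normedModType R).
Implicit Types (x y w : R -> H) (t : R) (v : H).

Lemma has_derivative_atB x y t v v' :
  has_derivative_at x t v -> has_derivative_at y t v' ->
  has_derivative_at (x - y) t (v - v').
Proof.
move=> xv yv; apply: cvg_trans (cvgB xv yv); apply: near_eq_cvg.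
by apply: nearW => s; rewrite !fctE -scalerBr !opprD !opprK addrACA.
Qed.

(** The increment is the difference quotient times [s - t], which tends to 0. *)
Lemma has_derivative_at_cvg x t v : has_derivative_at x t v ->
  x s @[s --> within `[0, +oo[ t^'] --> x t.
Proof.
move=> xv.
have ts0 : s - t @[s --> within `[0, +oo[ t^'] --> 0.
  rewrite -(subrr t); apply: cvgB; last exact: cvg_cst.
  exact: cvg_trans (cvg_within _) (@nbhs_dnbhs _ t).
have lim_x : (s - t) *: ((s - t)^-1 *: (x s - x t)) + x t
    @[s --> within `[0, +oo[ t^'] --> x t.
  rewrite -[X in _ --> X]add0r -[X in _ --> X + _](scale0r v).
  by apply: cvgD; [exact: cvgZ ts0 xv|exact: cvg_cst].
apply: cvg_trans lim_x; apply: near_eq_cvg.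
rewrite near_withinE; near=> s => _ /=.
have st : s - t != 0 by rewrite subr_eq0; near: s; exact: nbhs_dnbhs_neq.
by rewrite scalerA divff// scale1r subrK.
Unshelve. all: by end_near. Qed.

Lemma has_derivative_at_continuous x (dx : R -> H) :
  (forall t, 0 <= t -> has_derivative_at x t (dx t)) ->
  {within `[0, +oo[, continuous x}.
Proof.
move=> xdx; apply/subspace_continuousP => t /=; rewrite in_itv/= andbT => t0.
apply/cvgrPdist_le => e e0.
have /cvgrPdist_le/(_ e e0) := has_derivative_at_cvg (xdx t t0).
rewrite !near_withinE => near_e; near=> s => s0.
have [->|st] := eqVneq s t; first by rewrite subrr normr0 ltW.
by move: s0; move: st; near: s.
Unshelve. all: by end_near. Qed.

(** A positive time has a neighborhood contained in the half-line. *)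
Lemma dnbhs_within_half_line t : 0 < t -> t^' `=>` within `[0, +oo[ t^'.
Proof.
move=> t0 P; rewrite /within/= => Pt; near=> s.
have s0 : 0 < s by near: s; apply: nbhs_dnbhs; exact: lt_nbhsr.
suff : s \in `[0, +oo[ -> P s by apply; rewrite /= in_itv/= andbT ltW.
by near: s.
Unshelve. all: by end_near. Qed.

(** The difference quotient of the squared norm is the inner product of
    [w s + w t] with the difference quotient of [w]; this is also the
    slope function of Caratheodory's criterion. *)
Lemma is_derive_norm_sqr (dot : {dot H for idfun})
    (dotE : forall u : H, dot u u = `|u| ^+ 2) w t v :
  has_derivative_at w t v -> 0 < t ->
  is_derive t 1 (fun s => `|w s| ^+ 2) (2 * dot (w t) v).
Proof.
move=> wv t0.
have to_dnbhs (g : R -> H) l : g s @[s --> within `[0, +oo[ t^'] --> l ->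
    g s @[s --> t^'] --> l.
  apply: cvg_trans; apply: cvg_app; exact: dnbhs_within_half_line.
apply/is_derive1_caratheodory.
exists (fun s => if s == t then 2 * dot (w t) v else
             dot (w s + w t) ((s - t)^-1 *: (w s - w t))).
split; last by rewrite eqxx.
- move=> s; case: eqVneq => [->|st]; first by rewrite !subrr mulr0.
  by rewrite dotZr (dot_sum_diff dotE) mulrAC mulVf ?subr_eq0// mul1r.
- apply/continuous_withinNx; rewrite eqxx.
  have -> : 2 * dot (w t) v = dot (w t + w t) v by rewrite dotDl; ring.
  have lim_dot : dot (w s + w t) ((s - t)^-1 *: (w s - w t)) @[s --> t^']
      --> dot (w t + w t) v.
    apply: (cvg_dot dotE); last exact: to_dnbhs.
    by apply: cvgD; [exact/to_dnbhs/has_derivative_at_cvg/wv|exact: cvg_cst].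
  apply: cvg_trans lim_dot; apply: near_eq_cvg; near=> s.
  have st : s != t by near: s; exact: nbhs_dnbhs_neq.
  by rewrite (negPf st).
Unshelve. all: by end_near. Qed.

End HalfLineDerivative.

(** * Uniqueness *)

(** The derivative of [`|w| ^+ 2] is [2 * dot w dw], at most
    [(1 + M ^+ 2) * `|w| ^+ 2]; hence [expR (- c * t) * `|w t| ^+ 2] with
    [c = 1 + M ^+ 2] is nonincreasing, and it vanishes at 0. *)
Lemma gronwall_norm_sqr (R : realType) (H : normedModType R)
    (dot : {dot H for idfun}) (dotE : forall u : H, dot u u = `|u| ^+ 2)
    (w dw : R -> H) (M : R) :
  (forall t : R, 0 <= t -> has_derivative_at w t (dw t)) ->
  (forall t : R, 0 <= t -> `|dw t| <= M * `|w t|) -> w 0 = 0 ->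
  forall t : R, 0 <= t -> w t = 0.
Proof.
move=> wdw dw_le w0 t t0.
pose c := 1 + M ^+ 2.
pose E (s : R) : R := expR (- c * s).
pose g (s : R) : R := E s * `|w s| ^+ 2.
have dE (s : R) : is_derive s 1 E (- c * E s).
  rewrite /E; apply: is_derive_eq.
  by rewrite [(- c)%:A]mulr1 mulrC.
have dg (s : R) : 0 < s -> is_derive s 1 g
    (E s * (2 * dot (w s) (dw s)) + `|w s| ^+ 2 * (- c * E s)).
  move=> s0.
  have dn := is_derive_norm_sqr dotE (wdw s (ltW s0)) s0.
  exact: (is_deriveM (dE s) dn).
have g_nincr : g t <= g 0.
  apply: (@ler0_derive1_nincry _ g 0) => // [s|s|].
  - by rewrite in_itv/= andbT => /dg [].
  - rewrite in_itv/= andbT => s0; have dgs := dg s s0.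
    rewrite derive1E derive_val.
    have := dot_le dotE (w s) (dw s).
    have : `|dw s| ^+ 2 <= M ^+ 2 * `|w s| ^+ 2.
      have dws := dw_le s (ltW s0).
      rewrite -exprMn; apply: lerXn2r dws; rewrite nnegrE//.
      exact: le_trans (dw_le s (ltW s0)).
    have := expR_gt0 (- c * s); rewrite -/(E s) => E0.
    move=> dw2 dot2.
    have : E s * (2 * dot (w s) (dw s) - c * `|w s| ^+ 2) <= 0.
      by rewrite pmulr_rle0// /c; lra.
    lra.
  - apply/subspace_continuousP => s s0; apply: cvgM.
      apply: continuous_cvg; first exact: continuous_expR.
      apply: cvgMl_tmp; exact: cvg_within.
    rewrite expr2; under eq_fun do rewrite expr2.
    have /subspace_continuousP/(_ s s0) w_cvg :=
      has_derivative_at_continuous wdw.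
    by apply: cvgM; exact: cvg_norm.
apply/eqP; rewrite -normr_eq0 -sqrf_eq0 eq_le sqr_ge0 andbT.
rewrite -(pmulr_rle0 _ (expR_gt0 (- c * t))) -/(g t).
by rewrite (le_trans g_nincr)// /g w0 normr0 expr0n/= mulr0.
Qed.

(** * Existence and uniqueness *)

Section CauchyProblem.
Context (R : realType) (H : completeNormedModType R) (f : H -> H) (M : R).
Context (M_ge0 : 0 <= M) (f_lip : forall a b, `|f a - f b| <= M * `|a - b|).
Context (x0 : H).

Lemma euler_flow_solution : is_solution f x0 (euler_flow f x0).
Proof.
pose x := euler_flow f x0.
have xfx t : 0 <= t -> has_derivative_at x t (f (x t)).
  exact: euler_flow_derivative M_ge0 f_lip x0 t.
exists (fun t => f (x t)); split=> //; last exact: euler_flow0.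
split=> //; apply/subspace_continuousP => t t0.
have /subspace_continuousP/(_ t t0) x_cvg := has_derivative_at_continuous xfx.
by apply: continuous_cvg x_cvg; exact: (lipschitz_continuous f_lip).
Qed.

Lemma solution_unique (dot : {dot H for idfun})
    (dotE : forall u : H, dot u u = `|u| ^+ 2) (x y : R -> H) :
  is_solution f x0 x -> is_solution f x0 y -> forall t, 0 <= t -> y t = x t.
Proof.
move=> [dx [[xdx _] dxf x00]] [dy [[ydy _] dyf y00]] t t0.
have wdw s (s0 : 0 <= s) := has_derivative_atB (ydy s s0) (xdx s s0).
apply: subr0_eq; apply: (gronwall_norm_sqr dotE (M := M) wdw) => //.
- by move=> s s0; rewrite dyf// dxf.
- by rewrite !fctE y00 x00 subrr.
Qed.

End CauchyProblem.

(** The intermediate point [r], the projection onto [K b] of the point projected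
    at [a], separates the motion of the constraint set from that of the
    projected point. *)
Lemma vector_field_lipschitz (R : realType) (H : completeNormedModType R)
    (dot : {dot H for idfun}) (dotE : forall u : H, dot u u = `|u| ^+ 2)
    (F : H -> H) (L : R) (L_ge0 : 0 <= L)
    (F_lip : forall a b, `|F a - F b| <= L * `|a - b|) (K : H -> set H)
    (K_neq0 : forall x, K x !=set0) (K_closed : forall x, closed (K x))
    (K_convex : forall x, convex_set (K x : set (convex_lmodType H)))
    (l : R) (proj_lip : forall x y z : H,
      `|metric_proj (K x) z - metric_proj (K y) z| <= l * `|x - y|)
    (lambda : R) (lambda_ge0 : 0 <= lambda) (a b : H) :
  `|vector_field K lambda F a - vector_field K lambda F b| <=
  ((1 + lambda * L) * (l + 1 + lambda * L) + lambda * L + 1) * `|a - b|.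
Proof.
have step_lip u v : `|lambda *: (F u - F v)| <= lambda * L * `|u - v|.
  by rewrite normrZ ger0_norm// -mulrA ler_wpM2l.
rewrite /vector_field; set p := metric_proj _ _; set q := metric_proj (K b) _.
have pq : `|p - q| <= (l + 1 + lambda * L) * `|a - b|.
  pose r := metric_proj (K b) (a - lambda *: F a).
  have -> : p - q = (p - r) + (r - q) by rewrite addrA subrK.
  have := metric_proj_nonexpansive dotE (K_neq0 b) (K_closed b) (K_convex b)
    (a - lambda *: F a) (b - lambda *: F b).
  rewrite -/r -/q.
  have -> : a - lambda *: F a - (b - lambda *: F b) =
      (a - b) - lambda *: (F a - F b).
    by rewrite scalerBr !opprD !opprK addrACA.
  have := ler_normB (a - b) (lambda *: (F a - F b)).
  have := step_lip a b; have := ler_normD (p - r) (r - q).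
  have := proj_lip a b (a - lambda *: F a); rewrite -/p -/r; lra.
have -> : p + lambda *: (F a - F p) - a - (q + lambda *: (F b - F q) - b) =
    (p - q) - lambda *: (F p - F q) + lambda *: (F a - F b) - (a - b).
  have subACA (u v w z : H) : u - v - (w - z) = (u - w) - (v - z).
    by rewrite !opprD !opprK addrACA.
  rewrite subACA; congr (_ - _).
  by rewrite opprD addrACA !scalerBr subACA addrA addrAC.
have lL : 0 <= 1 + lambda * L by rewrite addr_ge0// mulr_ge0.
have := ler_wpM2l lL pq.
have := step_lip a b; have := step_lip p q.
have := ler_normB (p - q - lambda *: (F p - F q) + lambda *: (F a - F b))
  (a - b).
have := ler_normD (p - q - lambda *: (F p - F q)) (lambda *: (F a - F b)).
have := ler_normB (p - q) (lambda *: (F p - F q)).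
lra.
Qed.

Theorem theorem3p1 (R : realType) (H : completeNormedModType R)
    (dot : {dot H for idfun}) (dotE : forall u : H, dot u u = `|u| ^+ 2)
    (F : H -> H) (L rho : R) (L_gt0 : 0 < L) (rho_gt0 : 0 < rho)
    (F_lip : L.-lipschitz F) (F_mono : strongly_monotone dot rho F)
    (K : H -> set H)
    (K_neq0 : forall x, K x !=set0)
    (K_closed : forall x, closed (K x))
    (K_convex : forall x, convex_set (K x : set (convex_lmodType H)))
    (l : R) (l_ge0 : 0 <= l)
    (l_le : let gamma := L / rho in
      l <= 1 / (gamma * (gamma + Num.sqrt (gamma ^+ 2 - 1))))
    (proj_lip : forall x y z : H,
      `|metric_proj (K x) z - metric_proj (K y) z| <= l * `|x - y|)
    (lambda : R) (lambda_gt0 : 0 < lambda) (x0 : H) :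
  exists x : R -> H,
    is_solution (vector_field K lambda F) x0 x /\
    forall y : R -> H, is_solution (vector_field K lambda F) x0 y ->
      forall t, 0 <= t -> y t = x t.
Proof.
have f_lip := vector_field_lipschitz dotE (ltW L_gt0) (lipschitz_normB F_lip)
  K_neq0 K_closed K_convex proj_lip (ltW lambda_gt0).
have M_ge0 : 0 <= (1 + lambda * L) * (l + 1 + lambda * L) + lambda * L + 1.
  have := ltW lambda_gt0; have := ltW L_gt0 => L_ge0 lambda_ge0.
  by rewrite ?(addr_ge0, mulr_ge0).
have sol := euler_flow_solution M_ge0 f_lip x0.
exists (euler_flow (vector_field K lambda F) x0); split=> // y.
exact: solution_unique f_lip _ _ dotE _ _ sol.
Qed.
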